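(* For every integer $n\ge 1$ let $B_{2n}(x)$ be the polynomial of degree $2n$ with Chebyshev coordinates $[2,1,2,1,\ldots,2,1,1]$, that is, $$B_{2n}(x)=\sum_{j=0}^{n-1}\bigl(2T_{2j}(x)+T_{2j+1}(x)\bigr)+T_{2n}(x),$$ and let $B_{2n+1}(x)$ be the polynomial of degree $2n+1$ with Chebyshev coordinates $[1,2,1,2,1,\ldots,2,1,1]$, that is, $$B_{2n+1}(x)=\sum_{j=0}^{n-1}\bigl(T_{2j}(x)+2T_{2j+1}(x)\bigr)+T_{2n}(x)+T_{2n+1}(x).$$ Then for every integer $m\ge 2$ all the complex roots of $B_m(x)$ are real and lie in $[-2,2]$. Moreover, as $m\to+\infty$, the largest root of $B_m(x)$ tends to $2$ and the smallest root tends to $-2$.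
   Context: The Chebyshev polynomials used here are the monic integer polynomials $T_0(x)=1$ and, for $n>0$, $T_n(x)=x^n+\sum_{k=1}^{\lfloor n/2\rfloor}(-1)^k\frac nk\binom{n-k-1}{k-1}x^{n-2k}$; equivalently, for $n>0$, $T_n(2\cos\theta)=2\cos(n\theta)$ and $T_n(z+z^{-1})=z^n+z^{-n}$. Note the convention $T_0=1$ (not $2$). A polynomial has Chebyshev coordinates $[c_0,c_1,\ldots,c_d]$ if it equals $\sum_{j=0}^d c_jT_j(x)$. *)

(* Defs.v *)
From mathcomp Require Import all_boot all_order all_algebra.
From mathcomp Require Import complex.
From mathcomp Require Import all_classical all_reals all_analysis.

Set Implicit Arguments.
Unset Strict Implicit.
Unset Printing Implicit Defensive.

Import Order.TTheory GRing.Theory Num.Theory.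
Import numFieldNormedType.Exports.

Local Open Scope ring_scope.

Definition chebT_coef (n k : nat) : nat :=
  ((n * 'C(n - k - 1, k - 1)) %/ k)%N.

(* The division in [chebT_coef] is exact wherever [chebT] uses it. *)
Lemma chebT_coefE (n k : nat) : (0 < k)%N -> (k <= n./2)%N ->
  (k * chebT_coef n k = n * 'C(n - k - 1, k - 1))%N.
Proof.
case: k => // k _ le_k_n; rewrite /chebT_coef mulnC divnK //.
have le2 : (k.+1 <= n)%N.
  apply: leq_trans le_k_n _.
  by rewrite -{2}(odd_double_half n) -addnn addnA leq_addl.
rewrite -{1}(subnK le2) mulnDl dvdn_addl; last exact: dvdn_mulr.
by rewrite !subn1 /= mul_bin_diag dvdn_mulr.
Qed.

(* Normalised so that T_n(2 cos t) = 2 cos (n t) for n > 0, but T_0 = 1. *)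
Definition chebT (n : nat) : {poly int} :=
  'X^n + \sum_(1 <= k < n./2.+1)
           ((-1) ^+ k * (chebT_coef n k)%:R) *: 'X^(n - k.*2).

(* [B_even n] is B_(2n) and [B_odd n] is B_(2n+1), meaningful for n > 0. *)
Definition B_even (n : nat) : {poly int} :=
  \sum_(j < n) (chebT j.*2 *+ 2 + chebT j.*2.+1) + chebT n.*2.

Definition B_odd (n : nat) : {poly int} :=
  \sum_(j < n) (chebT j.*2 + chebT j.*2.+1 *+ 2) + chebT n.*2 + chebT n.*2.+1.

Definition B (m : nat) : {poly int} :=
  if odd m then B_odd m./2 else B_even m./2.

Definition largest_root (R : realType) (p : {poly R}) (x : R) : Prop :=
  root p x /\ forall y : R, root p y -> y <= x.

Definition smallest_root (R : realType) (p : {poly R}) (x : R) : Prop :=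
  root p x /\ forall y : R, root p y -> x <= y.

(* Main.v *)
(** Let [S_m] be the Chebyshev polynomial of the second kind, normalised by
    [S_m(2 cos t) sin t = sin (m t)]. Then [T_n = S_(n+1) - S_(n-1)] for [n > 0],
    and since [T_n + T_(n+1) + T_(n+2) = (X + 1) T_(n+1)], the recurrence
    [B_(m+2) = B_m + T_m + T_(m+1) + T_(m+2)] gives [B_m = (X + 1) S_m]. Hence the
    roots of [B_m] are [-1] and the [2 cos (k pi / m)] with [0 < k < m]. *)
Require Import Defs.
From mathcomp Require Import all_boot all_order all_algebra.
From mathcomp Require Import complex ring lra zify.
From mathcomp Require Import all_classical all_reals all_analysis.

Import Order.TTheory GRing.Theory Num.Theory.
Import numFieldNormedType.Exports.

Local Open Scope classical_set_scope.
Local Open Scope ring_scope.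
Local Open Scope complex_scope.

(** * Second-kind polynomials: recurrence, closed formula, link with [chebT] *)

Fixpoint chebS (n : nat) : {poly int} :=
  match n with
  | 0 => 0
  | n1.+1 => match n1 with 0 => 1 | n2.+1 => 'X * chebS n1 - chebS n2 end
  end.

Lemma chebSSS n : chebS n.+2 = 'X * chebS n.+1 - chebS n.
Proof. by []. Qed.

(** Terms of the closed formula for S_(n+1), not S_n. Past the middle the binomial vanishes, so the
    truncated exponent does no harm. *)
Definition chebS_term (n k : nat) : {poly int} :=
  ((-1) ^+ k * 'C(n - k, k)%:R) *: 'X^(n - k.*2).

Lemma chebS_term_small n k : (n < k.*2)%N -> chebS_term n k = 0.
Proof.
by move=> lt_n_2k; rewrite /chebS_term bin_small ?mulr0 ?scale0r //; lia.
Qed.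

Lemma chebS_term0 n : chebS_term n 0 = 'X^n.
Proof. by rewrite /chebS_term subn0 bin0 mulr1 scale1r. Qed.

(** Pascal's rule splits the binomial on the left; one part goes to each term of the recurrence. *)
Lemma chebS_termS n k :
  chebS_term n.+2 k.+1 = 'X * chebS_term n.+1 k.+1 - chebS_term n k.
Proof.
have -> : chebS_term n.+2 k.+1 =
    ((-1) ^+ k.+1 * ('C(n - k, k.+1) + 'C(n - k, k))%:R) *: 'X^(n - k.*2).
  rewrite /chebS_term subSS; have -> : (n.+2 - k.+1.*2 = n - k.*2)%N by lia.
  have [le_kn|lt_nk] := leqP k n; first by rewrite subSn // binS.
  by rewrite !bin_small //; lia.
have -> : 'X * chebS_term n.+1 k.+1 =
    ((-1) ^+ k.+1 * 'C(n - k, k.+1)%:R) *: 'X^(n - k.*2).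
  (* Otherwise the exponent on the left is truncated, and both sides are zero. *)
  have [le_kn|lt_nk] := leqP k.+1.*2 n.+1; last first.
    by rewrite chebS_term_small // bin_small ?mulr0 ?scale0r //; lia.
  rewrite /chebS_term subSS -scalerAr -exprS.
  by congr (_ *: 'X^_); lia.
rewrite /chebS_term natrD mulrDr scalerDl; congr (_ + _).
by rewrite exprS mulN1r mulNr scaleNr.
Qed.

(** The freedom in [N] lets sums for different [n] be matched term by term, here and in [chebTE]. *)
Lemma chebSE n N : (n < N.*2)%N -> chebS n.+1 = \sum_(k < N) chebS_term n k.
Proof.
elim/ltn_ind: n N => -[|[|n]] IHn [|N] // lt_n_2N.
- by rewrite big_ord_recl chebS_term0 big1 ?addr0 // => k _; apply: chebS_term_small.
- rewrite big_ord_recl chebS_term0 big1 ?addr0 /= ?mulr1 ?subr0 // => k _.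
  by apply: chebS_term_small; rewrite /bump /=; lia.
rewrite chebSSS (IHn n.+1 _ N.+1) ?(IHn n _ N) //; try lia.
rewrite !big_ord_recl !chebS_term0 mulrDr -exprS -addrA mulr_sumr -sumrB.
by congr (_ + _); apply: eq_bigr => k _; rewrite chebS_termS.
Qed.

(** With j = k + 1, absorption gives j C(n-j, j) = (n-j) C(n-j-1, j-1); adding j C(n-j-1, j-1) turns
    the factor n-j into n. *)
Lemma chebT_coef_bin n k : (k.+1 <= n./2)%N ->
  chebT_coef n k.+1 = ('C(n - k.+1, k.+1) + 'C(n - k.+2, k))%N.
Proof.
move=> le_kn; apply/eqP; rewrite -(@eqn_pmul2l k.+1) //; apply/eqP.
rewrite chebT_coefE // mulnDr -mul_bin_diag !subn1 /=.
have -> : (n - k.+1).-1 = (n - k.+2)%N by lia.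
by rewrite -mulnDl; congr (_ * _)%N; lia.
Qed.

(** The two binomials of [chebT_coef_bin] are the coefficients from S_(n+2) and, with k shifted by
    one, from S_n. *)
Lemma chebTE n : chebT n.+1 = chebS n.+2 - chebS n.
Proof.
case: n => [|n]; first by rewrite /chebT big_geq //= mulr1 !subr0 addr0.
rewrite (@chebSE n.+2 n./2.+2) ?(@chebSE n n./2.+1); try lia.
rewrite big_ord_recl chebS_term0 -addrA -sumrB; congr (_ + _).
rewrite big_add1 big_mkord; apply: eq_bigr => k _.
rewrite chebT_coef_bin; last by have := ltn_ord k; lia.
rewrite /chebS_term natrD mulrDr scalerDl !subSS; congr (_ + _).
rewrite exprS mulN1r mulNr scaleNr; congr (- (_ *: 'X^_)).
Qed.

(** * Factorisation of [B] over the integers *)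

Lemma chebT0 : chebT 0 = 1.
Proof. by rewrite /chebT big_geq // addr0. Qed.

(* False for [B_0 = 1], as [chebS 0 = 0]: the even case starts at [B_2]. *)
Lemma B_evenE n : B_even n.+1 = ('X + 1) * chebS n.+1.*2.
Proof.
elim: n => [|n IHn].
  by rewrite /B_even big_ord_recl big_ord0 !chebTE chebT0 /=; ring.
(* The coordinate on T_(2n+2) rises from 1 to 2, whence the first added term. *)
have -> : B_even n.+2 =
    B_even n.+1 + chebT n.+1.*2 + chebT n.+1.*2.+1 + chebT n.+2.*2.
  by rewrite /B_even big_ord_recr /=; ring.
rewrite IHn !doubleS !chebTE !chebSSS; ring.
Qed.

Lemma B_oddE n : B_odd n = ('X + 1) * chebS n.*2.+1.
Proof.
elim: n => [|n IHn].
  by rewrite /B_odd big_ord0 !chebTE chebT0 /=; ring.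
have -> : B_odd n.+1 =
    B_odd n + chebT n.*2.+1 + chebT n.+1.*2 + chebT n.+1.*2.+1.
  by rewrite /B_odd big_ord_recr /=; ring.
rewrite IHn !doubleS !chebTE !chebSSS; ring.
Qed.

Lemma B_chebS m : (0 < m)%N -> B m = ('X + 1) * chebS m.
Proof.
rewrite /B => m_gt0; have := odd_double_half m.
case: odd => /= def_m; first by rewrite B_oddE -[in RHS]def_m.
by case: m./2 def_m m_gt0 => [|n] <- // _; rewrite B_evenE.
Qed.

Lemma size_chebS n : size (chebS n) = n.
Proof.
elim/ltn_ind: n => -[|[|n]] IHn; rewrite ?size_poly0 ?size_poly1 // chebSSS.
have sizeX : size ('X * chebS n.+1) = n.+2.
  by rewrite mulrC size_mulX -?size_poly_eq0 IHn ?ltnS.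
by rewrite size_polyDl ?size_polyN sizeX ?IHn ?ltnS // leqW.
Qed.

Lemma monic_chebS n : chebS n.+1 \is monic.
Proof.
elim: n => [|n IHn]; first exact: monic1.
rewrite chebSSS monicE lead_coefDl; last first.
  by rewrite size_polyN mulrC size_mulX -?size_poly_eq0 !size_chebS.
by rewrite lead_coefM lead_coefX mul1r -monicE.
Qed.

(** * Roots over the reals *)

Section RealRoots.

Set Implicit Arguments.
Unset Strict Implicit.

Variable R : realType.
Implicit Types t x y : R.

Local Notation mapR := (map_poly (intr : int -> R)).

(** The recurrence becomes sin(a + t) + sin(a - t) = 2 cos t sin a with a = (n + 1) t. *)
Lemma chebS_cos n t : (mapR (chebS n)).[2 * cos t] * sin t = sin (n%:R * t).
Proof.
elim/ltn_ind: n => -[|[|n]] IHn; rewrite ?chebSSS.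
- by rewrite /= rmorph0 horner0 !mul0r sin0.
- by rewrite /= rmorph1 hornerC !mul1r.
rewrite rmorphB rmorphM /= map_polyX hornerD hornerN hornerM hornerX mulrBl -mulrA.
rewrite (IHn n.+1) // (IHn n) //.
have -> : n%:R * t = n.+1%:R * t - t by rewrite -natr1; ring.
have -> : n.+2%:R * t = n.+1%:R * t + t by rewrite -natr1; ring.
rewrite sinB sinD; ring.
Qed.

(* Indices are shifted: this is the angle [(k + 1) pi / m] for [m = n + 1]. *)
Definition chebS_angle n k : R := k.+1%:R * pi / n.+1%:R.

(** Roots of B_(n+1) with multiplicity: -1 occurs twice when 3 divides n + 1. *)
Definition B_roots n : seq R :=
  -1 :: [seq 2 * cos (chebS_angle n k) | k <- iota 0 n].

Lemma chebS_angle_itv n k : (k < n)%N -> 0 < chebS_angle n k < pi.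
Proof.
move=> lt_kn; rewrite divr_gt0 ?mulr_gt0 ?pi_gt0 //= ltr_pdivrMr // mulrC.
by rewrite ltr_pM2l ?pi_gt0 // ltr_nat ltnS.
Qed.

Lemma chebS_angle_itvcc n k : (k < n)%N -> chebS_angle n k \in `[0, pi]%R.
Proof. by move=> /chebS_angle_itv /andP[??]; rewrite in_itv /= !ltW. Qed.

(** A monic polynomial of degree n with n distinct known roots splits. They are distinct because
    cosine is injective on [0, pi]. *)
Lemma chebS_factor n :
  mapR (chebS n.+1) =
    \prod_(a <- [seq 2 * cos (chebS_angle n k) | k <- iota 0 n]) ('X - a%:P).
Proof.
have inj_intr : injective (intr : int -> R) by exact: intr_inj.
rewrite [LHS](@all_roots_prod_XsubC _ _
  [seq 2 * cos (chebS_angle n k) | k <- iota 0 n]).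
- by rewrite (monicP (monic_map _ (monic_chebS n))) scale1r.
- by rewrite size_map size_iota size_map_inj_poly ?size_chebS.
- apply/allP => _ /mapP[k + ->]; rewrite mem_iota => /andP[_ lt_kn].
  (* The sine can be cancelled from [chebS_cos], whose right side is sin((k + 1) pi) = 0. *)
  have sin_neq0 := lt0r_neq0 (sin_gt0_pi (chebS_angle_itv lt_kn)).
  apply/eqP/(mulIf sin_neq0).
  rewrite mul0r chebS_cos mulrC divfK ?pnatr_eq0 //.
  by rewrite mulr_natl -[pi *+ _]add0r (alternatingn (@sinDpi R)) sin0 mulr0.
rewrite uniq_rootsE map_inj_in_uniq ?iota_uniq // => j k.
have two_neq0 : 2 != 0 :> R by rewrite pnatr_eq0.
have angle_inj : injective (chebS_angle n).
  move=> i l /(mulIf (_ : n.+1%:R^-1 != 0)) /(mulIf (lt0r_neq0 (pi_gt0 R))).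
  by rewrite invr_eq0 pnatr_eq0 => /(_ isT) /eqP; rewrite eqr_nat => /eqP[].
rewrite !mem_iota !add0n /= => lt_jn lt_kn /(mulfI two_neq0).
by move=> /(cos_inj (chebS_angle_itvcc lt_jn) (chebS_angle_itvcc lt_kn)) /angle_inj.
Qed.

Lemma B_factor n : mapR (B n.+1) = \prod_(a <- B_roots n) ('X - a%:P).
Proof.
rewrite B_chebS // rmorphM /= rmorphD rmorph1 /= map_polyX chebS_factor.
by rewrite big_cons polyCN opprK.
Qed.

Lemma B_rootsP n x : x \in B_roots n ->
  x = -1 \/ exists2 k, (k < n)%N & x = 2 * cos (chebS_angle n k).
Proof.
rewrite inE => /predU1P[->|/mapP[k]]; [by left|rewrite mem_iota => lt_kn ->].
by right; exists k.
Qed.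

Lemma mem_B_roots n k : (k < n)%N -> 2 * cos (chebS_angle n k) \in B_roots n.
Proof. by move=> lt_kn; apply/orP; right; apply/mapP; exists k; rewrite ?mem_iota. Qed.

Lemma B_roots_bound n x : x \in B_roots n -> -2 <= x <= 2.
Proof.
case/B_rootsP => [->|[k _ ->]]; first by lra.
by have := cos_geN1 (chebS_angle n k); have := cos_le1 (chebS_angle n k); lra.
Qed.

(** * Extreme roots and their limits *)

Definition top_root m : R := 2 * cos (pi / m%:R).
Definition bottom_root m : R := Num.min (-1) (- top_root m).

Lemma chebS_angle0 n : chebS_angle n 0 = pi / n.+1%:R.
Proof. by rewrite /chebS_angle mul1r. Qed.

(** The last angle mirrors the first, so the least root of S_(n+2) is minus its greatest. *)
Lemma chebS_angle_max n : chebS_angle n.+1 n = pi - pi / n.+2%:R.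
Proof.
have def_npi : n.+1%:R * pi = n.+2%:R * pi - pi :> R.
  by rewrite -[n.+2%:R]natr1 mulrDl mul1r addrK.
by rewrite /chebS_angle def_npi mulrBl mulrAC divff ?mul1r ?pnatr_eq0.
Qed.

Lemma cosBpi t : cos (pi - t) = - cos t.
Proof. by rewrite addrC cosDpi cosN. Qed.

Lemma cos_angle_le n k : (k < n)%N -> 2 * cos (chebS_angle n k) <= top_root n.+1.
Proof.
move=> lt_kn; have n_gt0 : (0 < n)%N by apply: leq_trans lt_kn.
rewrite /top_root -chebS_angle0 ler_pM2l // leNgt.
rewrite ltr_cos ?chebS_angle_itvcc // -leNgt ler_pM2r ?invr_gt0 //.
by rewrite ler_pM2r ?pi_gt0 // ler_nat.
Qed.

Lemma cos_angle_ge n k : (k < n)%N -> - top_root n.+1 <= 2 * cos (chebS_angle n k).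
Proof.
case: n => // n lt_kn.
rewrite /top_root -mulrN -cosBpi -chebS_angle_max ler_pM2l // leNgt.
rewrite ltr_cos ?chebS_angle_itvcc // -leNgt ler_pM2r ?invr_gt0 //.
by rewrite ler_pM2r ?pi_gt0 // ler_nat.
Qed.

(** The angle is at most pi/2. This places the extra root -1 below [top_root]. *)
Lemma top_root_ge0 n : 0 <= top_root n.+2.
Proof.
rewrite mulr_ge0 // cos_ge0_pihalf //; apply/andP; split.
  by rewrite (@le_trans _ _ 0) ?oppr_le0 ?divr_ge0 ?pi_ge0.
by rewrite ler_pM2l ?pi_gt0 // lef_pV2 ?posrE // ler_nat.
Qed.

Lemma top_rootP n : largest_root (mapR (B n.+2)) (top_root n.+2).
Proof.
rewrite /largest_root B_factor; split.
  by rewrite root_prod_XsubC /top_root -chebS_angle0 mem_B_roots.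
move=> y; rewrite root_prod_XsubC => /B_rootsP[->|[k lt_kn ->]].
  by rewrite (@le_trans _ _ 0) ?top_root_ge0 // oppr_le0.
exact: cos_angle_le.
Qed.

(* For [m = 2] the smallest root is [-1]; for [m > 2] it is [- top_root m]. *)
Lemma bottom_rootP n : smallest_root (mapR (B n.+2)) (bottom_root n.+2).
Proof.
rewrite /smallest_root B_factor; split.
  rewrite root_prod_XsubC /bottom_root minElt; case: ifP => _.
    by rewrite inE eqxx.
  by rewrite /top_root -mulrN -cosBpi -chebS_angle_max mem_B_roots.
move=> y; rewrite root_prod_XsubC ge_min => /B_rootsP[->|[k lt_kn ->]].
  by rewrite lexx.
by rewrite cos_angle_ge ?orbT.
Qed.

Lemma cvg_top_root : top_root @ \oo --> (2 : R).
Proof.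
rewrite -[X in _ --> X]mulr1 -[X in 2 * X]cos0.
apply: cvgM; first exact: cvg_cst.
apply: continuous_cvg; first exact: continuous_cos.
rewrite -[X in _ --> X](mulr0 (pi : R)); apply: cvgM; first exact: cvg_cst.
(* The harmonic sequence is 1/(n + 1), hence the shift. *)
by rewrite -cvg_shiftS; apply: cvg_harmonic.
Qed.

Lemma cvg_bottom_root : bottom_root @ \oo --> (-2 : R).
Proof.
have <- : Num.min (-1) (-2) = -2 :> R.
  by rewrite min_r // lerN2 ler1n.
apply: (continuous2_cvg _ (@min_continuous _ R (-1, -2))); first exact: cvg_cst.
by apply: cvgN; apply: cvg_top_root.
Qed.

(** The splitting over the reals persists over [R[i]], so no further roots appear. *)
Lemma B_complex_root n (z : R[i]) :
  root (map_poly intr (B n.+1)) z -> exists2 x, x \in B_roots n & z = x%:C.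
Proof.
have -> : map_poly intr (B n.+1) = map_poly (real_complex R) (mapR (B n.+1)).
  by rewrite -map_poly_comp; apply: eq_map_poly => k /=; rewrite rmorph_int.
rewrite B_factor map_prod_XsubC.
by rewrite -(big_map (real_complex R) predT (fun a => 'X - a%:P)) root_prod_XsubC => /mapP.
Qed.

End RealRoots.

Theorem mainTheorem3 (R : realType) :
  (forall m : nat, (2 <= m)%N ->
     forall z : R[i], root (map_poly (intr : int -> R[i]) (B m)) z ->
       exists x : R, z = x%:C /\ -2 <= x <= 2)
  /\ exists u v : nat -> R,
       (forall m : nat, (2 <= m)%N ->
          largest_root (map_poly (intr : int -> R) (B m)) (u m) /\
          smallest_root (map_poly (intr : int -> R) (B m)) (v m))
       /\ u @ \oo --> (2 : R)
       /\ v @ \oo --> (-2 : R).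
Proof.
split=> [[|m] // _ z /B_complex_root[x xB ->]|].
  by exists x; split=> //; apply: B_roots_bound; exact: xB.
exists (@top_root R), (@bottom_root R); split=> [[|[|m]] // _|].
  by split; [exact: top_rootP|exact: bottom_rootP].
by split; [exact: cvg_top_root|exact: cvg_bottom_root].
Qed.
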